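(* Let $\mathbb{D}\in\{\mathbb{R},\mathbb{C},\mathbb{H}\}$, let $p,q\in\mathbb{N}$ with $p+q=n$, and let $J=\begin{pmatrix}\mathrm{Id}_p&0\\0&-\mathrm{Id}_q\end{pmatrix}$. There is a one-to-one correspondence (bijection) between the set of $J$-Kubo-Ando means on $\mathscr{P}_J$ and the set of Kubo-Ando means on $\mathscr{P}$.
   Context: $\mathrm{Mat}_n(\mathbb{D})$ is the set of $n\times n$ matrices over $\mathbb{D}$ and $\mathrm{GL}_n(\mathbb{D})$ its invertible elements. For $X\in\mathrm{Mat}_n(\mathbb{D})$: $X^*=\overline{X}^{t}$ (conjugate transpose, quaternionic conjugation if $\mathbb{D}=\mathbb{H}$) and $X^\sharp=JX^*J$. Set $\mathfrak{p}=\{X\in\mathrm{Mat}_n(\mathbb{D}):X=X^*\}$, $\mathscr{P}=\{X\in\mathfrak{p}:X>0\}$ (positive definite; for $\mathbb{D}=\mathbb{H}$, all right eigenvalues positive), $\mathfrak{p}_J=\{X\in\mathrm{Mat}_n(\mathbb{D}):X=X^\sharp\}$, $\mathscr{P}_J=\{X\in\mathfrak{p}_J: JX>0\}$. Orders: on $\mathscr{P}$, $A\preceq B$ if $B-A$ is positive semi-definite; on $\mathscr{P}_J$, $A\preceq_J B$ if $JA\preceq JB$. A Kubo-Ando mean on $\mathscr{P}$ is a continuous map $\sigma:\mathscr{P}\times\mathscr{P}\to\mathscr{P}$ such that (1) $A\preceq B$, $C\preceq D$ imply $A\,\sigma\,C\preceq B\,\sigma\,D$; (2) $g(A\,\sigma\,B)g^*=(gAg^*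 )\,\sigma\,(gBg^* )$ for all $g\in\mathrm{GL}_n(\mathbb{D})$, $A,B\in\mathscr{P}$; (3) $\mathrm{Id}_n\,\sigma\,\mathrm{Id}_n=\mathrm{Id}_n$. A $J$-Kubo-Ando mean on $\mathscr{P}_J$ is a continuous map $\sigma_J:\mathscr{P}_J\times\mathscr{P}_J\to\mathscr{P}_J$ such that (1) $A\preceq_J B$, $C\preceq_J D$ imply $A\,\sigma_J\,C\preceq_J B\,\sigma_J\,D$; (2) $g^\sharp(A\,\sigma_J\,B)g=(g^\sharp Ag)\,\sigma_J\,(g^\sharp Bg)$ for all $g\in\mathrm{GL}_n(\mathbb{D})$, $A,B\in\mathscr{P}_J$; (3) $J\,\sigma_J\,J=J$. *)

(* Defs.v *)
From HB Require Import structures.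
From mathcomp Require Import all_boot all_order all_algebra.
From mathcomp Require Import all_classical all_reals all_analysis.
From mathcomp Require Import complex.
From mathcomp Require Import ring.

Set Implicit Arguments.
Unset Strict Implicit.
Unset Printing Implicit Defensive.

Import Order.TTheory GRing.Theory Num.Theory.
Import numFieldNormedType.Exports.

Local Open Scope classical_set_scope.
Local Open Scope ring_scope.

(* (a, b, c, d) stands for a + b i + c j + d k.  The additive group and the
   (product) topology are those of R^4; the multiplication is NOT the
   componentwise one carried by the product type. *)
Definition quaternion (R : realType) : Type := (R * R * R * R)%type.

Section Quaternion.
Variable R : realType.
Implicit Types x y z : quaternion R.

HB.instance Definition _ :=
  GRing.Zmodule.copy (quaternion R) (R * R * R * R)%type.
HB.instance Definition _ :=
  Topological.copy (quaternion R) (R * R * R * R)%type.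

Definition quat_real (r : R) : quaternion R := (r, 0, 0, 0).

Definition quat_mul x y : quaternion R :=
  let: (a, b, c, d) := x in let: (a', b', c', d') := y in
  (a * a' - b * b' - c * c' - d * d',
   a * b' + b * a' + c * d' - d * c',
   a * c' - b * d' + c * a' + d * b',
   a * d' + b * c' - c * b' + d * a').

Definition quat_conj x : quaternion R :=
  let: (a, b, c, d) := x in (a, - b, - c, - d).

Lemma quat_mulA : associative quat_mul.
Proof.
by move=> [[[a b] c] d] [[[? ?] ?] ?] [[[? ?] ?] ?] /=; do !congr pair; ring.
Qed.

Lemma quat_mul1l : left_id (quat_real 1) quat_mul.
Proof. by move=> [[[a b] c] d] /=; do !congr pair; ring. Qed.

Lemma quat_mul1r : right_id (quat_real 1) quat_mul.
Proof. by move=> [[[a b] c] d] /=; do !congr pair; ring. Qed.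

Lemma quat_mulDl : left_distributive quat_mul +%R.
Proof.
move=> [[[a b] c] d] [[[? ?] ?] ?] [[[? ?] ?] ?] /=.
by do !congr pair => /=; ring.
Qed.

Lemma quat_mulDr : right_distributive quat_mul +%R.
Proof.
move=> [[[a b] c] d] [[[? ?] ?] ?] [[[? ?] ?] ?] /=.
by do !congr pair => /=; ring.
Qed.

Lemma quat_1neq0 : quat_real 1 != 0.
Proof. by apply/eqP => -[] /eqP; rewrite oner_eq0. Qed.

HB.instance Definition _ := GRing.Zmodule_isNzRing.Build (quaternion R)
  quat_mulA quat_mul1l quat_mul1r quat_mulDl quat_mulDr quat_1neq0.

End Quaternion.

#[short(type="topNzRingType")]
HB.structure Definition TopNzRing := {D of GRing.NzRing D & Topological D}.

HB.instance Definition _ (R : realType) := GRing.NzRing.on R^o.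
HB.instance Definition _ (R : realType) :=
  Topological.copy R[i] ((R[i] : numFieldType)^o).
HB.instance Definition _ (R : realType) := GRing.NzRing.on R[i].
HB.instance Definition _ (R : realType) := GRing.NzRing.on (quaternion R).

Variant division_algebra := Reals | Complexes | Quaternions.

Section Scalars.
Variable R : realType.

Definition divalg (d : division_algebra) : topNzRingType :=
  match d with
  | Reals => R^o
  | Complexes => R[i]
  | Quaternions => quaternion R
  end.

Definition scalar_conj (d : division_algebra) : divalg d -> divalg d :=
  match d return divalg d -> divalg d with
  | Reals => id
  | Complexes => @conjc R
  | Quaternions => @quat_conj R
  end.

Definition scalar_real (d : division_algebra) : R -> divalg d :=
  match d return R -> divalg d with
  | Reals => id
  | Complexes => fun r => (r%:C)%C
  | Quaternions => @quat_real R
  end.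

Definition scalar_pos d (z : divalg d) :=
  exists2 r : R, 0 < r & z = scalar_real d r.
Definition scalar_nneg d (z : divalg d) :=
  exists2 r : R, 0 <= r & z = scalar_real d r.

Lemma scalar_normP d (z : divalg d) : exists r : R,
  [/\ 0 <= r, z != 0 -> 0 < r & scalar_conj z * z = scalar_real d r].
Proof.
case: d z => [x|[a b]|[[[a b] c] e]] /=.
- exists (x ^+ 2); split; rewrite ?sqr_ge0// => x0.
  by rewrite lt_def sqr_ge0 sqrf_eq0 x0.
- exists (a ^+ 2 + b ^+ 2); split; first by rewrite addr_ge0 ?sqr_ge0.
    rewrite eq_complex /= negb_and lt_def addr_ge0 ?sqr_ge0// andbT.
    by rewrite paddr_eq0 ?sqr_ge0// !sqrf_eq0 negb_and.
  by apply/eqP; rewrite eq_complex /=; apply/andP; split; apply/eqP; ring.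
- exists (a ^+ 2 + b ^+ 2 + c ^+ 2 + e ^+ 2).
  have h (x y : R) : 0 <= x -> 0 <= x + y ^+ 2.
    by move=> ?; rewrite addr_ge0 ?sqr_ge0.
  split; [by rewrite !h ?sqr_ge0| |].
    rewrite lt_def !h ?sqr_ge0// andbT; apply: contra.
    rewrite !paddr_eq0 ?h ?sqr_ge0// !sqrf_eq0.
    by move=> /andP[/andP[/andP[/eqP-> /eqP->] /eqP->] /eqP->].
  by do !congr pair => /=; ring.
Qed.

Lemma scalar_realD d : {morph scalar_real d : x y / x + y}.
Proof.
case: d => x y //=; first exact: (rmorphD (real_complex R)).
by do !congr pair => /=; ring.
Qed.

Lemma scalar_realM d : {morph scalar_real d : x y / x * y}.
Proof.
case: d => x y //=; first exact: (rmorphM (real_complex R)).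
by do !congr pair => /=; ring.
Qed.

Lemma scalar_real1 d : scalar_real d 1 = 1.
Proof. by case: d. Qed.

Lemma scalar_real0 d : scalar_real d 0 = 0.
Proof. by case: d. Qed.

Lemma scalar_conj0 d : scalar_conj (0 : divalg d) = 0.
Proof.
by case: d => //=; [exact: (rmorph0 (@conjc R))|rewrite /quat_conj/= !oppr0].
Qed.

Lemma scalar_conj1 d : scalar_conj (1 : divalg d) = 1.
Proof.
by case: d => //=; [exact: (rmorph1 (@conjc R))|rewrite /quat_conj/= !oppr0].
Qed.

Lemma scalar_conjN d (z : divalg d) : scalar_conj (- z) = - scalar_conj z.
Proof.
by case: d z => //=; [exact: (rmorphN (@conjc R))|move=> [[[a b] c] e]].
Qed.

Lemma scalar_mulf_eq0 d (x y : divalg d) : x * y = 0 -> x != 0 -> y = 0.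
Proof.
move=> xy0 x0; have [r [_ /(_ x0) r0 xE]] := scalar_normP x.
have : scalar_real d r^-1 * scalar_conj x * (x * y) = 0 by rewrite xy0 mulr0.
by rewrite mulrA -(mulrA _ (scalar_conj x)) xE -scalar_realM mulVf ?gt_eqF//
  scalar_real1 mul1r.
Qed.

End Scalars.

Section Means.
Variables (R : realType) (d : division_algebra).
Local Notation D := (divalg R d).

Definition adjmx m n (X : 'M[D]_(m, n)) : 'M[D]_(n, m) :=
  (map_mx (@scalar_conj R d) X)^T.

Definition GLmx n : set 'M[D]_n :=
  [set g | exists h, g *m h = 1%:M /\ h *m g = 1%:M].

(* Scalars act on column vectors on the right: X v = v l. *)
Definition right_eigenvalue n (X : 'M[D]_n) (l : D) :=
  exists2 v : 'cV[D]_n, v != 0 & X *m v = map_mx (fun z => z * l) v.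

(* These two predicates are only used on Hermitian matrices. *)
Definition posdefmx n (X : 'M[D]_n) : Prop :=
  match d with
  | Quaternions => forall l, right_eigenvalue X l -> scalar_pos l
  | _ => forall v : 'cV[D]_n, v != 0 -> scalar_pos ((adjmx v *m X *m v) 0 0)
  end.

Definition possemidefmx n (X : 'M[D]_n) : Prop :=
  match d with
  | Quaternions => forall l, right_eigenvalue X l -> scalar_nneg l
  | _ => forall v : 'cV[D]_n, scalar_nneg ((adjmx v *m X *m v) 0 0)
  end.

Definition hermitian_set n : set 'M[D]_n := [set X | X = adjmx X].

Definition posdef_cone n : set 'M[D]_n :=
  [set X | hermitian_set X /\ posdefmx X].
Arguments posdef_cone n : clear implicits.

Definition loewner n (A B : 'M[D]_n) : Prop := possemidefmx (B - A).

Section Signature.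
Variables p q : nat.

Definition signmx : 'M[D]_(p + q) := block_mx 1%:M 0 0 (- 1%:M).

Definition sharpmx (X : 'M[D]_(p + q)) := signmx *m adjmx X *m signmx.

Definition J_hermitian_set : set 'M[D]_(p + q) := [set X | X = sharpmx X].

Definition J_posdef_cone : set 'M[D]_(p + q) :=
  [set X | J_hermitian_set X /\ posdefmx (signmx *m X)].

Definition J_loewner (A B : 'M[D]_(p + q)) : Prop :=
  loewner (signmx *m A) (signmx *m B).

End Signature.
Arguments J_posdef_cone p q : clear implicits.

Lemma adjmx1 n : adjmx (1%:M : 'M[D]_n) = 1%:M.
Proof.
apply/matrixP => i j; rewrite !mxE eq_sym.
by case: eqP => _; rewrite ?scalar_conj1 ?scalar_conj0.
Qed.

Lemma posdefmx1 n : posdefmx (1%:M : 'M[D]_n).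
Proof.
have eig l : right_eigenvalue (1%:M : 'M[D]_n) l -> scalar_pos l.
  move=> [v v0]; rewrite mul1mx => vl.
  have [i vi0] : exists i, v i 0 != 0.
    apply/existsP; apply: contraNT v0 => /existsPn v0.
    apply/eqP/matrixP => i j; rewrite ord1 mxE.
    by have /negPn/eqP := v0 i.
  have /scalar_mulf_eq0 : v i 0 * (l - 1) = 0.
    by rewrite mulrBr mulr1 [in X in _ - X]vl mxE subrr.
  move=> /(_ vi0)/eqP; rewrite subr_eq0 => /eqP ->.
  by exists 1 => //; rewrite scalar_real1.
have qf (v : 'cV[D]_n) : v != 0 -> scalar_pos ((adjmx v *m 1%:M *m v) 0 0).
  move=> v0; rewrite mulmx1 mxE.
  have [N NP] := choice (fun i => scalar_normP (v i 0)).
  exists (\sum_i N i).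
    have N0 i : 0 <= N i by have [] := NP i.
    rewrite lt_def sumr_ge0// andbT; apply: contra v0.
    rewrite psumr_eq0// => /allP NE; apply/eqP/matrixP => i j.
    rewrite ord1 [RHS]mxE; apply/eqP/negPn/negP => vi0.
    have [_ /(_ vi0)] := NP i.
    by have /= /eqP -> := NE i (mem_index_enum i); rewrite ltxx.
  rewrite (big_morph _ (@scalar_realD R d) (@scalar_real0 R d)).
  by apply: eq_bigr => i _; rewrite !mxE; have [] := NP i.
by rewrite /posdefmx; case: {1}d.
Qed.

Lemma id_posdef_subproof n : posdef_cone n (1%:M : 'M[D]_n).
Proof. by split; [rewrite /hermitian_set /= adjmx1|exact: posdefmx1]. Qed.

Lemma signmxK p q : signmx p q *m signmx p q = 1%:M.
Proof.
rewrite /signmx mulmx_block !mulmx0 !mul0mx mulmxN mulNmx !mulmx1 opprK.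
by rewrite !addr0 !add0r -scalar_mx_block.
Qed.

Lemma adj_signmx p q : adjmx (signmx p q) = signmx p q.
Proof.
rewrite /adjmx /signmx map_block_mx tr_block_mx; congr block_mx.
- exact: adjmx1.
- by apply/matrixP => i j; rewrite !mxE scalar_conj0.
- by apply/matrixP => i j; rewrite !mxE scalar_conj0.
- rewrite -[in RHS]adjmx1; apply/matrixP => i j; rewrite !mxE.
  by rewrite scalar_conjN.
Qed.

Lemma sign_J_posdef_subproof p q : J_posdef_cone p q (signmx p q).
Proof.
split; last by rewrite signmxK; exact: posdefmx1.
by rewrite /J_hermitian_set /= /sharpmx adj_signmx signmxK mul1mx.
Qed.

Definition id_posdef n : posdef_cone n :=
  SigSub (mem_set (@id_posdef_subproof n)).

Definition sign_J_posdef p q : J_posdef_cone p q :=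
  SigSub (mem_set (@sign_J_posdef_subproof p q)).

(* The sets posdef_cone and J_posdef_cone used as types carry the subspace
   topology.  In the congruence axioms A' and B' are the matrices g A g^* and
   g B g^* (resp. g^# A g and g^# B g) seen as elements of the cone. *)
Record Kubo_Ando n (s : posdef_cone n * posdef_cone n -> posdef_cone n) :
    Prop := {
  Kubo_Ando_continuous : continuous s;
  Kubo_Ando_monotone : forall A B C E : posdef_cone n,
    loewner (\val A) (\val B) -> loewner (\val C) (\val E) ->
    loewner (\val (s (A, C))) (\val (s (B, E)));
  Kubo_Ando_congruence :
    forall (g : 'M[D]_n) (A B A' B' : posdef_cone n), GLmx g ->
    \val A' = g *m \val A *m adjmx g -> \val B' = g *m \val B *m adjmx g ->
    g *m \val (s (A, B)) *m adjmx g = \val (s (A', B'));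
  Kubo_Ando_id : s (id_posdef n, id_posdef n) = id_posdef n
}.

Record J_Kubo_Ando p q
    (s : J_posdef_cone p q * J_posdef_cone p q -> J_posdef_cone p q) : Prop := {
  J_Kubo_Ando_continuous : continuous s;
  J_Kubo_Ando_monotone : forall A B C E : J_posdef_cone p q,
    J_loewner (\val A) (\val B) -> J_loewner (\val C) (\val E) ->
    J_loewner (\val (s (A, C))) (\val (s (B, E)));
  J_Kubo_Ando_congruence :
    forall (g : 'M[D]_(p + q)) (A B A' B' : J_posdef_cone p q), GLmx g ->
    \val A' = sharpmx g *m \val A *m g -> \val B' = sharpmx g *m \val B *m g ->
    sharpmx g *m \val (s (A, B)) *m g = \val (s (A', B'));
  J_Kubo_Ando_sign :
    s (sign_J_posdef p q, sign_J_posdef p q) = sign_J_posdef p q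
}.

End Means.
Arguments posdef_cone R d n : clear implicits.
Arguments J_posdef_cone R d p q : clear implicits.

(* Main.v *)
Require Import Defs.
From mathcomp Require Import all_boot all_order all_algebra.
From mathcomp Require Import all_classical all_reals all_analysis.
From mathcomp Require Import complex ring.

Import GRing.Theory.
Import numFieldNormedType.Exports.

Local Open Scope classical_set_scope.

(** Multiplication by J turns everything on the J-side into its counterpart on
    the ordinary side.  As J is a self-adjoint involution, X = J X^* J says
    exactly that J X is Hermitian, so X |-> J X maps the J-cone onto the
    positive definite cone, with inverse Y |-> J Y.  The entries of J X are
    those of X up to sign, hence this is a homeomorphism; the J-order is the
    Loewner order pulled back along it, and J itself corresponds to the
    identity.  Congruences correspond too: J (g^# A g) = g^* (J A) g, so the
    J-congruence by g is the congruence by g^*, and g |-> g^* is a bijection of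
    the general linear group because the adjoint reverses products.

    Consequently conjugating a binary operation by this homeomorphism
    ([transport], with inverse [transport_back]) exchanges the two lists of
    axioms one by one ([Kubo_Ando_transport], [J_Kubo_Ando_transport_back]). *)

Section Adjoint.
Local Open Scope ring_scope.
Variables (R : realType) (d : division_algebra).
Local Notation D := (divalg R d).

Lemma scalar_conjK : involutive (@scalar_conj R d).
Proof.
case: d => //=; first exact: conjcK.
by move=> [[[a b] c] e]; rewrite /quat_conj !opprK.
Qed.

Lemma scalar_conjD : {morph @scalar_conj R d : x y / x + y}.
Proof.
case: d => //=; first exact: (rmorphD (@conjc R)).
by move=> [[[a b] c] e] [[[a' b'] c'] e']; do !congr pair => /=; ring.
Qed.

Lemma scalar_conjM (x y : D) :
  scalar_conj (x * y) = scalar_conj y * scalar_conj x.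
Proof.
case: d x y => /=.
- by move=> x y; exact: mulrC.
- by move=> x y; rewrite (rmorphM (@conjc R)) mulrC.
- by move=> [[[a b] c] e] [[[a' b'] c'] e']; do !congr pair => /=; ring.
Qed.

Lemma adjmxK m n : cancel (@adjmx R d m n) (@adjmx R d n m).
Proof. by move=> X; apply/matrixP => i j; rewrite !mxE scalar_conjK. Qed.

Lemma adjmxM m n k (X : 'M[D]_(m, n)) (Y : 'M[D]_(n, k)) :
  adjmx (X *m Y) = adjmx Y *m adjmx X.
Proof.
apply/matrixP => i j; rewrite !mxE.
rewrite (big_morph _ scalar_conjD (@scalar_conj0 R d)).
by apply: eq_bigr => l _; rewrite !mxE scalar_conjM.
Qed.

Lemma GLmx_adj n (g : 'M[D]_n) : GLmx g -> GLmx (adjmx g).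
Proof.
move=> [h [gh hg]]; exists (adjmx h).
by rewrite -!adjmxM gh hg adjmx1.
Qed.

End Adjoint.

Section Continuity.
Local Open Scope ring_scope.

(** Only a ring and a topology are given on the scalars, with no compatibility
    between them, so this has to be read off the underlying normed spaces:
    for the quaternions, R^4 with its product topology. *)
Lemma divalg_opp_continuous (R : realType) (d : division_algebra) :
  continuous (-%R : divalg R d -> divalg R d).
Proof.
case: d.
- exact: (@oppr_continuous _ R^o).
- exact: (@oppr_continuous _ (R[i] : numFieldType)^o).
- exact: (@oppr_continuous _ (R * R * R * R)%type).
Qed.

Lemma continuous_ext (S T : topologicalType) (f g : S -> T) :
  f =1 g -> continuous f -> continuous g.
Proof. by move=> /funext ->. Qed.

Lemma mx_entry_continuous (T : topologicalType) m n i j :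
  continuous (fun X : 'M[T]_(m, n) => X i j).
Proof.
move=> X A XA.
exists (fun k l => if (k == i) && (l == j) then A else setT).
  by move=> k l; case: ifP => [/andP[/eqP-> /eqP->]//|_]; exact: filterT.
by move=> Y /(_ i j); rewrite !eqxx.
Qed.

(** A basic neighbourhood of a matrix imposes one condition per entry, that is,
    finitely many conditions. *)
Lemma mx_continuous (S T : topologicalType) m n (f : S -> 'M[T]_(m, n)) :
  (forall i j, continuous (fun x => f x i j)) -> continuous f.
Proof.
move=> fc x A [P fxP PA].
have fP : nbhs x [set y | forall k : 'I_m * 'I_n, P k.1 k.2 (f y k.1 k.2)].
  by apply: filter_forall => -[i j]; exact: (fc i j x _ (fxP i j)).
by apply: filterS fP => y yP; apply: PA => i j; exact: (yP (i, j)).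
Qed.

Lemma set_type_continuous (S T : topologicalType) (A : set T) (f : S -> A) :
  continuous (fun x => \val (f x)) -> continuous f.
Proof.
move=> fc; apply/continuousP => _ [U oU <-].
by move/continuousP: fc; exact.
Qed.

Lemma val_continuous (T : topologicalType) (A : set T) :
  continuous (\val : A -> T).
Proof. exact: initial_continuous. Qed.

Lemma continuous_conjugate (S T : topologicalType) (u : S -> T) (v : T -> S)
    (s : S * S -> S) : continuous u -> continuous v -> continuous s ->
  continuous (fun XY : T * T => u (s (v XY.1, v XY.2))).
Proof.
move=> uc vc sc XY; apply: (@continuous_comp _ _ _ _ u); last exact: uc.
apply: (@continuous_comp _ _ _ (fun XY : T * T => (v XY.1, v XY.2)) s).
  apply: cvg_pair.
    by apply: (@continuous_comp _ _ _ fst v); [exact: cvg_fst|exact: vc].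
  by apply: (@continuous_comp _ _ _ snd v); [exact: cvg_snd|exact: vc].
exact: sc.
Qed.

(** Addition and multiplication of scalars are avoided: left multiplication by J
    keeps the upper rows and negates the lower ones, so that continuity of the
    opposite suffices. *)
Lemma signmx_mul_continuous (R : realType) (d : division_algebra) p q n :
  continuous (fun X : 'M[divalg R d]_(p + q, n) => signmx R d p q *m X).
Proof.
apply: mx_continuous => i j.
have signE (X : 'M[divalg R d]_(p + q, n)) :
    signmx R d p q *m X = col_mx (usubmx X) (- dsubmx X).
  rewrite -{1}(vsubmxK X) /signmx mul_block_col.
  by rewrite !mul0mx mulNmx !mul1mx addr0 add0r.
case: (split_ordP i) => k ->.
  apply: continuous_ext (@mx_entry_continuous (divalg R d) _ _ (lshift q k) j).
  by move=> X; rewrite signE col_mxEu mxE.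
apply: (@continuous_ext _ _
    (-%R \o (fun X : 'M[divalg R d]_(_, _) => X (rshift p k) j))).
  by move=> X /=; rewrite signE col_mxEd !mxE.
move=> X; apply: continuous_comp; first exact: mx_entry_continuous.
exact: divalg_opp_continuous.
Qed.

End Continuity.

Section Transport.
Local Open Scope ring_scope.
Variables (R : realType) (d : division_algebra) (p q : nat).
Local Notation D := (divalg R d).
Local Notation J := (signmx R d p q).
Local Notation P := (posdef_cone R d (p + q)).
Local Notation PJ := (J_posdef_cone R d p q).

Lemma signmx_mulK n : involutive (@mulmx D _ _ n J).
Proof. by move=> X; rewrite mulmxA signmxK mul1mx. Qed.

Lemma sharpmx_adj (g : 'M[D]_(p + q)) : sharpmx (adjmx g) = J *m g *m J.
Proof. by rewrite /sharpmx adjmxK. Qed.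

(** X = J X^* J gives J X = X^* J = (J X)^*. *)
Lemma posdef_sign_mul (X : 'M[D]_(p + q)) : PJ X -> P (J *m X).
Proof.
move=> [XE Xpos]; split => //; rewrite /hermitian_set /= adjmxM adj_signmx.
by rewrite [in LHS]XE /sharpmx -mulmxA signmx_mulK.
Qed.

Lemma J_posdef_sign_mul (X : 'M[D]_(p + q)) : P X -> PJ (J *m X).
Proof.
move=> [XE Xpos]; split; last by rewrite signmx_mulK.
rewrite /J_hermitian_set /= /sharpmx adjmxM adj_signmx -!mulmxA signmxK mulmx1.
by rewrite -XE.
Qed.

Definition to_posdef (X : PJ) : P :=
  SigSub (mem_set (posdef_sign_mul _ (set_mem (valP X)))).

Definition to_J_posdef (X : P) : PJ :=
  SigSub (mem_set (J_posdef_sign_mul _ (set_mem (valP X)))).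

Lemma to_posdefK : cancel to_posdef to_J_posdef.
Proof. by move=> X; apply: val_inj; exact: signmx_mulK. Qed.

Lemma to_J_posdefK : cancel to_J_posdef to_posdef.
Proof. by move=> X; apply: val_inj; exact: signmx_mulK. Qed.

Lemma to_posdef_continuous : continuous to_posdef.
Proof.
apply: set_type_continuous => X.
apply: (@continuous_comp PJ 'M[D]_(p + q) 'M[D]_(p + q) \val (mulmx J));
  first exact: val_continuous.
exact: signmx_mul_continuous.
Qed.

Lemma to_J_posdef_continuous : continuous to_J_posdef.
Proof.
apply: set_type_continuous => X.
apply: (@continuous_comp P 'M[D]_(p + q) 'M[D]_(p + q) \val (mulmx J));
  first exact: val_continuous.
exact: signmx_mul_continuous.
Qed.

Lemma to_posdef_sign : to_posdef (sign_J_posdef R d p q) = id_posdef R d (p + q).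
Proof. by apply: val_inj; exact: signmxK. Qed.

Lemma to_J_posdef_id : to_J_posdef (id_posdef R d (p + q)) = sign_J_posdef R d p q.
Proof. by rewrite -to_posdef_sign to_posdefK. Qed.

Definition transport (s : PJ * PJ -> PJ) (XY : P * P) : P :=
  to_posdef (s (to_J_posdef XY.1, to_J_posdef XY.2)).

Definition transport_back (s : P * P -> P) (XY : PJ * PJ) : PJ :=
  to_J_posdef (s (to_posdef XY.1, to_posdef XY.2)).

Lemma transportK : cancel transport transport_back.
Proof.
by move=> s; apply/funext => -[X Y];
  rewrite /transport_back /transport /= !to_posdefK.
Qed.

Lemma transport_backK : cancel transport_back transport.
Proof.
by move=> s; apply/funext => -[X Y];
  rewrite /transport_back /transport /= !to_J_posdefK.
Qed.

(** For the congruence axiom the parameter on the J-side is g^*: since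
    (g^* )^# = J g J, one has (g^* )^# (J A) g^* = J (g A g^* ). *)
Lemma Kubo_Ando_transport s : J_Kubo_Ando s -> Kubo_Ando (transport s).
Proof.
move=> [sc smono scong ssign]; split.
- exact: continuous_conjugate to_posdef_continuous to_J_posdef_continuous sc.
- by move=> A B C E AB CE; apply: smono; rewrite /J_loewner /= !signmx_mulK.
- move=> g A B A' B' gG A'E B'E.
  have := @scong (adjmx g) (to_J_posdef A) (to_J_posdef B)
    (to_J_posdef A') (to_J_posdef B') (@GLmx_adj R d _ g gG).
  rewrite sharpmx_adj /= A'E B'E -!mulmxA !signmx_mulK.
  by rewrite /transport /= => <- //; rewrite signmx_mulK.
- by rewrite /transport /= to_J_posdef_id ssign to_posdef_sign.
Qed.

Lemma J_Kubo_Ando_transport_back s :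
  Kubo_Ando s -> J_Kubo_Ando (transport_back s).
Proof.
move=> [sc smono scong sid]; split.
- exact: continuous_conjugate to_J_posdef_continuous to_posdef_continuous sc.
- by move=> A B C E AB CE; rewrite /J_loewner /= !signmx_mulK; exact: smono.
- move=> g A B A' B' gG A'E B'E.
  have := @scong (adjmx g) (to_posdef A) (to_posdef B)
    (to_posdef A') (to_posdef B') (@GLmx_adj R d _ g gG).
  rewrite adjmxK /= A'E B'E /sharpmx -!mulmxA !signmx_mulK.
  by rewrite /transport_back /= => <-.
- by rewrite /transport_back /= to_posdef_sign sid to_J_posdef_id.
Qed.

End Transport.

Theorem corollary4p4 (R : realType) (d : division_algebra) (p q : nat) :
  exists f : (J_posdef_cone R d p q * J_posdef_cone R d p q -> J_posdef_cone R d p q) ->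
             (posdef_cone R d (p + q) * posdef_cone R d (p + q) -> posdef_cone R d (p + q)),
    set_bij [set s | @J_Kubo_Ando R d p q s]
            [set s | @Kubo_Ando R d (p + q) s] f.
Proof.
exists (@transport R d p q); split.
- by move=> s; exact: Kubo_Ando_transport.
- by move=> s t _ _; exact: (can_inj (@transportK R d p q)).
- move=> s sKA; exists (@transport_back R d p q s).
  exact: J_Kubo_Ando_transport_back.
  exact: transport_backK.
Qed.
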